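(* Given integers $k\ge2$ and $m\ge3k$, consider a balanced weighting of a graph $D\in\mathcal{D}_k$ with total weight $m$, which yields a graph $G\in\mathcal{B}_m(D)$. Then $G$ minimizes $d_3(\cdot)$ within the set $\mathcal{B}_m(\mathcal{D}_k)=\bigcup_{D'\in\mathcal{D}_k}\mathcal{B}_m(D')$ if and only if all 3-bonds of $D$ are trivial and the $\pi^{\mathrm v}$-values of $D$ are balanced. (The latter condition is vacuous when $3k$ divides $m$.)
   Context: Graphs are finite connected multigraphs, considered up to isomorphism. $d_i(G)$ is the number of sets of $i$ edges of $G$ whose deletion disconnects $G$. $\mathcal{D}_k$ is the set of 3-edge-connected cubic graphs with $2k$ vertices and $3k$ edges. A weighting of $D\in\mathcal{D}_k$ assigns to each edge $e$ a nonnegative integer $\ell(e)$ such that every cycle of $D$ has positive total weight; it yields the weak subdivision of $D$ obtained by contracting each edge of weight $0$ and replacing each edge of weight $\ell\ge1$ by a path with $\ell$ edges. The weighting (and the resulting graph) is balanced if all weights pairwise differ by at most one. $\mathcal{B}_m(D)$ is the set of graphs with $m$ edges that arise from balanced weightings of $D$ (necessarily of total weight $m$). Write $m=3kq+r$ with integers $q,r$ and $-3k/2<r\le 3k/2$; then a balanced weighting of total weight $m$ has $3k-|r|$ edges of weight $q$ and $|r|$ edges of weight $q+1$ (if $r>0$) or $q-1$ (if $r<0$). For a vertex $u$ of $D$, $\pi^{\mathrm v}(u)$ is the number of edges incident to $u$ of weight $q+1$ minus the number of edges incident to $u$ of weight $q-1$. The $\pi^{\mathrm v}$-values of $D$ are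 balanced if they pairwise differ by at most one. A bond is a minimal cut (a minimal edge set among sets of edges crossing a partition of the vertices into two nonempty sets); a 3-bond is a bond with three edges. A 3-bond of $D$ is trivial if it consists of the three edges incident to some vertex. *)

(* Defs.v *)
From HB Require Import structures.
From mathcomp Require Import all_boot all_order all_algebra.

Set Implicit Arguments.
Unset Strict Implicit.
Unset Printing Implicit Defensive.

Import Order.TTheory GRing.Theory Num.Theory.

(* Finite multigraphs, loops and parallel edges allowed.  The order of the two
   ends of an edge carries no meaning: see [joins] and [mgraph_iso]. *)
Record mgraph := MGraph {
  vert : finType;
  edge : finType;
  ends : edge -> vert * vert
}.

Section Graphs.

Variable G : mgraph.
Implicit Types (F S C : {set edge G}) (A : {set vert G}) (x y : vert G).

Definition joins (e : edge G) x y : bool :=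
  (ends e == (x, y)) || (ends e == (y, x)).

Definition incident (e : edge G) x : bool :=
  ((ends e).1 == x) || ((ends e).2 == x).

Definition star x : {set edge G} := [set e | incident e x].

(* Degree of x in the spanning subgraph with edge set F; loops count twice. *)
Definition degree F x : nat :=
  #|[set e in F | (ends e).1 == x]| + #|[set e in F | (ends e).2 == x]|.

Definition adj F : rel (vert G) := fun x y => [exists e in F, joins e x y].

Definition spanning_connected F : bool :=
  [forall x, forall y, connect (adj F) x y].

Definition disconnecting S : bool := ~~ spanning_connected (~: S).

Definition ndisc (i : nat) : nat :=
  #|[set S : {set edge G} | (#|S| == i) && disconnecting S]|.

Definition edge_connected (n : nat) : Prop :=
  forall S, #|S| < n -> ~~ disconnecting S.

Definition cubic : Prop := forall x, degree setT x = 3.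

(* Cycles as edge sets: edge sets of connected 2-regular subgraphs (a loop and
   a pair of parallel edges are cycles). *)
Definition is_cycle C : bool :=
  [&& C != set0,
      [forall x, (degree C x == 0) || (degree C x == 2)] &
      [forall x, forall y,
         (0 < degree C x) && (0 < degree C y) ==> connect (adj C) x y]].

Definition crossing A : {set edge G} :=
  [set e | ((ends e).1 \in A) != ((ends e).2 \in A)].

Definition is_cut S : bool :=
  [exists A : {set vert G}, [&& A != set0, A != setT & S == crossing A]].

Definition is_bond S : bool := minset is_cut S.

Definition trivial_3bonds : Prop :=
  forall S, is_bond S -> #|S| = 3 -> exists u, S = star u.

End Graphs.

Arguments edge_connected : clear implicits.

Definition mgraph_iso (G H : mgraph) : Prop :=
  exists (f : vert G -> vert H) (g : edge G -> edge H),
    [/\ bijective f, bijective g &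
        forall e, joins (g e) (f (ends e).1) (f (ends e).2)].

Definition in_Dk (k : nat) (D : mgraph) : Prop :=
  [/\ edge_connected D 3, cubic D, #|vert D| = 2 * k & #|edge D| = 3 * k].

Section Weightings.

Variables (D : mgraph) (l : edge D -> nat).

Definition is_weighting : Prop :=
  forall C, is_cycle C -> 0 < \sum_(e in C) l e.

Definition total_weight : nat := \sum_e l e.

Definition balanced : Prop := forall e f, l e <= (l f).+1.

(* The vertices of D merged with x when the edges of weight 0 are contracted. *)
Definition zclass (x : vert D) : {set vert D} :=
  [set y | connect (adj [set e | l e == 0]) x y].

Definition zclasses : {set {set vert D}} := [set zclass x | x in setT].

Definition branch_vert : finType := {A : {set vert D} | A \in zclasses}.

Definition branch (x : vert D) : branch_vert :=
  Sub (zclass x) (imset_f zclass (in_setT x)).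

(* An edge e is replaced by a path with l e edges and (l e).-1 new internal
   vertices (none if l e = 0). *)
Definition inner_vert : finType := {e : edge D & 'I_(l e).-1}.

Definition wsub_vert : finType := (branch_vert + inner_vert)%type.

Definition wsub_edge : finType := {e : edge D & 'I_(l e)}.

(* The i-th vertex, 0 <= i <= l e, of the path replacing e: for 0 < i < l e it
   is the inner vertex numbered i.-1. *)
Definition path_vert (e : edge D) (i : nat) : wsub_vert :=
  if i == 0 then inl (branch (ends e).1)
  else if insub i.-1 is Some j
       then inr (Tagged (fun e0 => 'I_(l e0).-1) (j : 'I_(l e).-1))
       else inl (branch (ends e).2).

Definition weak_subdivision : mgraph :=
  @MGraph wsub_vert wsub_edge
    (fun p => let i : nat := tagged p in
              (path_vert (tag p) i, path_vert (tag p) i.+1)).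

(* The value pi^v(u), relative to the base weight q. *)
Definition piv (q : int) (u : vert D) : int :=
  (#|[set e in star u | (l e)%:Z == q + 1]|%:Z
   - #|[set e in star u | (l e)%:Z == q - 1]|%:Z)%R.

Definition piv_balanced (q : int) : Prop :=
  forall u v, (`|piv q u - piv q v| <= 1)%R.

End Weightings.

(* Graphs are considered up to isomorphism, so B_m(D) is closed under it. *)
Definition in_B (m : nat) (D G : mgraph) : Prop :=
  exists l : edge D -> nat,
    [/\ is_weighting l, balanced l, total_weight l = m
      & mgraph_iso (weak_subdivision l) G].

Definition in_BDk (m k : nat) (G : mgraph) : Prop :=
  exists D, in_Dk k D /\ in_B m D G.

Definition minimizes (f : mgraph -> nat) (P : mgraph -> Prop) (G : mgraph) :
  Prop := P G /\ forall G', P G' -> f G <= f G'.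

(* Main.v *)
Require Import Defs.
From mathcomp Require Import all_boot all_order all_algebra.
From mathcomp Require Import zify ring.

Set Implicit Arguments.
Unset Strict Implicit.
Unset Printing Implicit Defensive.

Import Order.TTheory GRing.Theory Num.Theory.

(** Since m >= 3k, all weights of a balanced weighting are positive, so that G is
    a genuine subdivision of D.  A triple of edges of G fails to disconnect G
    exactly when its edges lie on the paths of three different edges of D that
    form a nondisconnecting triple of D ([disconnecting_wsub]).  Counting gives
    ([ndisc_wsub_disconnecting])

      d_3(G) + e_3(l) = binom(m, 3) + sum_T prod_(e in T) l(e),

    where T ranges over the disconnecting triples of D and e_3 is the third
    elementary symmetric function.  A balanced weighting takes the value q on
    3k - |r| edges and one other value w on b = |r| edges ([balanced_values]), so
    e_3(l) depends on k and m only, and it remains to minimize the sum over T.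

    The graph D being cubic and 3-edge-connected, its disconnecting triples are
    its 3-bonds, among them the 2k stars of its vertices.  The sum over T is thus
    at least the sum over the stars, with equality if and only if all 3-bonds are
    trivial ([sum_disconnecting3_eq]).  The star of u contributes
    q ^ (3 - j) * w ^ j, where j = |pi^v(u)| is the number of its edges of weight
    w.  This is a strictly convex function of j, and the sum of j over all
    vertices is 2b.  Comparison with the chord through the two integers around
    the mean b / k bounds the sum over the stars from below, with equality if and
    only if the values of j pairwise differ by at most one ([sum_star_prod]).

    Together these give a lower bound for d_3 on B_m(D_k) that depends on k and m
    only, and G attains it if and only if both conditions of the theorem hold
    ([min_ndisc3_le]).  The bound is attained for all k and m: all 3-bonds of a
    Möbius ladder are trivial, and giving the weight w to the first b edges in a
    list of the rungs followed by every second rim edge, which are two disjoint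
    perfect matchings, makes the values of j balanced since b <= 3k/2
    ([exists_extremal]).  So the minimizers are the graphs that attain it. *)

(** * Cuts and disconnecting edge sets *)

(** Reduces connectivity to two-colourings of the vertices. *)
Lemma disconnectingP (G : mgraph) (S : {set edge G}) :
  reflect (exists A : {set vert G},
             [/\ A != set0, A != setT & crossing A \subset S])
          (disconnecting S).
Proof.
apply: (iffP idP) => [|[A [A0 AT sub]]].
- case/forallPn => x /forallPn [y Nxy].
  exists [set z | connect (adj (~: S)) x z]; split.
  + by apply/set0Pn; exists x; rewrite inE connect0.
  + by apply: contraNneq Nxy => /setP/(_ y); rewrite !inE.
  apply/subsetP => e; rewrite !inE; apply: contraR => eS.
  have e12 : connect (adj (~: S)) (ends e).1 (ends e).2.
    apply/connect1/existsP; exists e; rewrite inE eS /joins.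
    by rewrite -surjective_pairing eqxx.
  have e21 : connect (adj (~: S)) (ends e).2 (ends e).1.
    apply/connect1/existsP; exists e; rewrite inE eS /joins.
    by rewrite -surjective_pairing eqxx orbT.
  by apply/eqP; apply/idP/idP => h; apply: connect_trans h _.
- case/set0Pn: A0 => x xA.
  have /subsetPn [y _ yA] : ~~ (setT \subset A) by rewrite subTset.
  apply/negP => /forallP /(_ x) /forallP /(_ y) cxy.
  have clA : closed (adj (~: S)) [in A].
    move=> u v /existsP [e /andP [eS euv]].
    have : e \notin crossing A.
      by apply: contraTN eS => /(subsetP sub); rewrite inE negbK.
    rewrite inE negbK => /eqP.
    by case/orP: euv => /eqP -> /=.
  by have := closed_connect clA cxy; rewrite /= xA (negPf yA).
Qed.

Lemma disconnecting_iso (G H : mgraph) (f : vert G -> vert H)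
    (g : edge G -> edge H) (S : {set edge G}) :
  bijective f -> bijective g ->
  (forall e, joins (g e) (f (ends e).1) (f (ends e).2)) ->
  disconnecting (g @: S) = disconnecting S.
Proof.
move=> bf bg fg.
have [f' fK f'K] := bf; have [g' gK g'K] := bg.
have crE (A : {set vert H}) e :
    (g e \in crossing A) = (e \in crossing (f @^-1: A)).
  rewrite !inE; case/orP: (fg e) => /eqP -> //=.
  by rewrite eq_sym.
apply/disconnectingP/disconnectingP => -[A [A0 AT sub]].
- exists (f @^-1: A); split.
  + case/set0Pn: A0 => x xA; apply/set0Pn; exists (f' x).
    by rewrite inE f'K.
  + apply: contraNneq AT => AT; apply/eqP/setP => x.
    by have /setP/(_ (f' x)) := AT; rewrite !inE f'K.
  + apply/subsetP => e; rewrite -crE => /(subsetP sub).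
    by rewrite mem_imset //; apply: bij_inj.
- have fA : f @^-1: (f @: A) = A.
    by apply/setP => x; rewrite inE mem_imset //; apply: bij_inj.
  exists (f @: A); split.
  + by rewrite imset_eq0.
  + by apply: contraNneq AT => AT; rewrite -fA AT; apply/eqP/setP => x; rewrite !inE.
  + apply/subsetP => e; rewrite -(g'K e) crE fA => /(subsetP sub) h.
    exact: imset_f.
Qed.

Lemma ndisc_iso (G H : mgraph) i : mgraph_iso G H -> ndisc H i = ndisc G i.
Proof.
case=> f [g [bf bg fg]].
have [g' gK g'K] := bg.
have gi : injective g := can_inj gK.
rewrite /ndisc -[RHS](card_imset _ (imset_inj gi)).
apply: eq_card => S.
have -> : S = g @: (g' @: S).
  by rewrite -imset_comp -[LHS]imset_id; apply: eq_imset => y /=; rewrite g'K.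
by rewrite (mem_imset _ _ (imset_inj gi)) !inE card_imset // (disconnecting_iso _ bf).
Qed.

(** * Disconnecting sets of a subdivision *)

(** A two-colouring of an integer interval with differently coloured ends changes
    colour at some step. *)
Lemma change_step (g : nat -> bool) a b :
  a <= b -> g a != g b -> exists i, [/\ a <= i, i < b & g i != g i.+1].
Proof.
move=> ab; rewrite -(subnKC ab); elim: (b - a) => [|n IHn].
  by rewrite addn0 eqxx.
have [-> ne|ne _] := eqVneq (g a) (g (a + n)).
  by exists (a + n); rewrite leq_addr addnS leqnn; split=> //; rewrite -addnS.
by have [i [ai ib gi]] := IHn ne; exists i; split=> //; rewrite addnS ltnW.
Qed.

Section Subdivision.

Variables (D : mgraph) (l : edge D -> nat).

Lemma branch_inj : (forall e, 0 < l e) -> injective (branch l).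
Proof.
move=> l_gt0 x y /(congr1 val) /= /setP /(_ y); rewrite !inE connect0.
have cl : closed (adj [set e | l e == 0]) [in [set x]].
  move=> u v /existsP [e]; rewrite inE => /andP [/eqP le0 _].
  by have := l_gt0 e; rewrite le0.
by move/(closed_connect cl); rewrite !inE eqxx => /esym /eqP.
Qed.

Lemma branch_surj (b : branch_vert l) : exists x, b = branch l x.
Proof.
have /imsetP [x _ bx] := valP b.
by exists x; apply: val_inj.
Qed.

(** The three kinds of vertices on the path that replaces e, with their
    positions. *)
Variant path_vert_spec (e : edge D) (n : nat) : wsub_vert l -> Prop :=
| PathStart of n = 0 : path_vert_spec e n (inl (branch l (ends e).1))
| PathEnd of n = l e : path_vert_spec e n (inl (branch l (ends e).2))
| PathInner (j : 'I_(l e).-1) of n = j.+1 :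
    path_vert_spec e n (inr (Tagged (fun e0 => 'I_(l e0).-1) j)).

Lemma path_vertP e n : n <= l e -> path_vert_spec e n (path_vert l e n).
Proof.
rewrite /path_vert; case: eqVneq => [-> _|n0 nl]; first exact: PathStart.
case: insubP => [j _ jn|]; first by apply: PathInner; move: jn => /= ->; lia.
rewrite -leqNgt => h; apply: PathEnd; lia.
Qed.

Lemma path_vert_last e : 0 < l e -> path_vert l e (l e) = inl (branch l (ends e).2).
Proof. by move=> h; case: path_vertP => // [h1|j h1]; [lia | have := ltn_ord j; lia]. Qed.

Let W := weak_subdivision l.

(** Two deleted edges on the path that replaces a single edge cut off the
    inner vertices between them. *)
Lemma disconnecting_same_path (S : {set edge W}) (p p' : wsub_edge l) :
  p \in S -> p' \in S -> p != p' -> tag p = tag p' -> disconnecting S.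
Proof.
case: p p' => [e i] [e' j] /= iS jS + ee'.
move: ee' j jS => <- j jS; rewrite eq_Tagged /= => ij.
wlog ltij : i j iS jS ij / i < j.
  move=> wl; have [/wl||/val_inj eqij] := ltngtP i j; first exact.
    by apply: wl => //; rewrite eq_sym.
  by rewrite eqij eqxx in ij.
(* the inner vertices at the positions i.+1, ..., j *)
pose c (z : vert W) := match z with
  | inl _ => false
  | inr v => (tag v == e) && (i <= tagged v < j) end.
have cE e1 n : n <= l e1 -> c (path_vert l e1 n) = (e1 == e) && (i < n <= j).
  case/path_vertP => /= [->|->|k ->]; rewrite ?andbF // ?ltnS //.
  by apply/esym/negP => /andP [/eqP -> ]; have := ltn_ord j; lia.
apply/disconnectingP; exists [set z | c z]; split.
- apply/set0Pn; exists (path_vert l e j); rewrite inE cE ?eqxx ?ltij ?leqnn //.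
  exact: ltnW.
- apply/eqP => /setP /(_ (inl (branch l (ends e).1))).
  by rewrite !inE.
- apply/subsetP => -[e1 t]; rewrite !inE /= !cE ?(ltnW (ltn_ord t)) //.
  case: (eqVneq e1 e) => //= e1e; move: t; rewrite e1e => t.
  have [/val_inj->//|ti] := eqVneq (t : nat) i.
  have [/val_inj->//|tj] := eqVneq (t : nat) j.
  by move=> h; exfalso; lia.
Qed.

(** A cut of D contained in the image of S lifts to the subdivision: the path
    replacing a crossing edge changes sides at an edge of S. *)
Lemma disconnecting_wsub_image (S : {set edge W}) :
  (forall e, 0 < l e) ->
  disconnecting ((fun p : wsub_edge l => tag p) @: S) -> disconnecting S.
Proof.
move=> l_gt0 /disconnectingP [A [A0 AT sub]].
have binj := branch_inj l_gt0.
(* the place where the path replacing e is cut; 0 if it is not cut *)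
pose pos e : nat :=
  if [pick p in S | tag p == e] is Some p then tagged p else 0.
have pos_lt e : pos e < l e.
  rewrite /pos; case: pickP => // p /andP [_ /eqP <-]; exact: ltn_ord.
pose c (z : vert W) := match z with
  | inl b => [exists x in A, branch l x == b]
  | inr v => if tagged v < pos (tag v) then (ends (tag v)).1 \in A
             else (ends (tag v)).2 \in A end.
have cb x : c (inl (branch l x)) = (x \in A).
  apply/existsP/idP => [[y /andP [yA /eqP/binj <-]] //|xA].
  by exists x; rewrite xA eqxx.
have cE e n : n <= l e ->
    c (path_vert l e n) = if n <= pos e then (ends e).1 \in A
                          else (ends e).2 \in A.
  case/path_vertP => [->|->|k ->]; rewrite ?cb //.
  by rewrite leqNgt pos_lt.
apply/disconnectingP; exists [set z | c z]; split.
- case/set0Pn: A0 => x xA; apply/set0Pn; exists (inl (branch l x)).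
  by rewrite inE cb.
- apply: contraNneq AT => cT; apply/eqP/setP => x.
  by have /setP/(_ (inl (branch l x))) := cT; rewrite !inE cb.
- apply/subsetP => -[e t]; rewrite !inE /= !cE ?(ltnW (ltn_ord t)) // => h.
  have tpos : t = pos e :> nat.
    by move: h; case: ltngtP => //; rewrite ?eqxx // => h1; case: leqP => h2;
      rewrite ?eqxx //; lia.
  move: h; rewrite tpos leqnn ltnn => cross.
  have /imsetP [p pS ep] : e \in (fun p : wsub_edge l => tag p) @: S.
    by apply: (subsetP sub); rewrite inE.
  move: tpos; rewrite /pos; case: pickP => [[e1 j] /andP [jS /eqP /= e1e]|].
    by move: j jS; rewrite e1e => j jS /val_inj ->.
  by move/(_ p); rewrite pS -ep eqxx.
Qed.

(** A cut of the subdivision that contains at most one edge of each path separates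
    branch vertices, since each path changes sides at most once. *)
Lemma disconnecting_wsub_inj (S : {set edge W}) :
  (forall e, 0 < l e) ->
  {in S &, injective (fun p : wsub_edge l => tag p)} ->
  disconnecting S -> disconnecting ((fun p : wsub_edge l => tag p) @: S).
Proof.
move=> l_gt0 inj /disconnectingP [A [A0 AT sub]].
pose g e n := path_vert l e n \in A.
have cut e a b : a <= b <= l e -> g e a != g e b ->
    exists t : 'I_(l e), a <= t < b /\ Tagged (fun e => 'I_(l e)) t \in S.
  case/andP => ab bl /(change_step ab) [i [ai ib gi]].
  exists (Ordinal (leq_trans ib bl)); rewrite /= ai ib; split=> //.
  by apply: (subsetP sub); rewrite inE /=.
pose B := [set x | inl (branch l x) \in A].
have gB0 e : g e 0 = ((ends e).1 \in B) by rewrite inE.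
have gBl e : g e (l e) = ((ends e).2 \in B) by rewrite inE /g path_vert_last.
have Bnc v : (forall x, (x \in B) = v) -> forall z, (z \in A) = v.
  move=> Bv [b|[e j]].
    by have [x ->] := branch_surj b; rewrite -(Bv x) inE.
  have jl : j.+1 < l e by have := ltn_ord j; lia.
  have gj : g e j.+1 = (inr (Tagged (fun e0 => 'I_(l e0).-1) j) \in A).
    rewrite /g; congr (_ \in A).
    by case: (path_vertP (ltnW jl)) => [//|h|i [] /val_inj -> //]; lia.
  rewrite -gj; apply/eqP; apply/idPn => ne.
  have [||t1 [h1 S1]] := cut e 0 j.+1; [lia|by rewrite gB0 Bv eq_sym|].
  have [||t2 [h2 S2]] := cut e j.+1 (l e); [lia|by rewrite gBl Bv|].
  have /eqP := inj _ _ S1 S2 erefl.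
  by rewrite eq_Tagged /= => /eqP t12; move: h1 h2; rewrite t12; lia.
apply/disconnectingP; exists B; split.
- apply: contraNneq A0 => B0; apply/eqP/setP => z.
  by rewrite (Bnc false) ?inE // => x; rewrite B0 inE.
- apply: contraNneq AT => BT; apply/eqP/setP => z.
  by rewrite (Bnc true) ?inE // => x; rewrite BT inE.
- apply/subsetP => e; rewrite inE -gB0 -gBl.
  case/cut => [|t [_ tS]]; first by rewrite leqnn.
  by apply/imsetP; eexists; first exact: tS.
Qed.

Lemma disconnecting_wsub (S : {set edge W}) :
  (forall e, 0 < l e) ->
  disconnecting S =
    (#|(fun p : wsub_edge l => tag p) @: S| != #|S|)
    || disconnecting ((fun p : wsub_edge l => tag p) @: S).
Proof.
move=> l_gt0; apply/idP/orP => [dS|[]]; last exact: disconnecting_wsub_image.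
  case: eqP => [/eqP/imset_injP inj|]; last by left.
  by right; apply: disconnecting_wsub_inj.
move/imset_injP => Ninj; apply: (contraT (b := disconnecting S)) => NdS; case: Ninj => p p' pS p'S tpp'.
by apply: contraNeq NdS => pp'; apply: disconnecting_same_path pS p'S pp' tpp'.
Qed.

End Subdivision.

(** * Counting disconnecting sets of a subdivision *)

(** The number of sets containing exactly one edge of the path of each e in T and
    no others.  They correspond to the partial functions [f] on T with [f e] an
    edge of the path of e. *)
Lemma card_tag_transversals (I : finType) (l : I -> nat) (T : {set I}) :
  #|[set S : {set {e : I & 'I_(l e)}} |
      ([set tag p | p in S] == T) && (#|S| == #|T|)]|
  = \prod_(e in T) l e.
Proof.
pose P : finType := {e : I & 'I_(l e)}.
pose F (e : I) := [pred o : option P | if o is Some p then tag p == e else false].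
have cardF e : #|F e| = l e.
  have -> : #|F e| = #|[set Some (Tagged (fun e => 'I_(l e)) i : P) | i : 'I_(l e)]|.
    apply: eq_card => -[[e1 i]|] /=; rewrite !inE /=; last first.
      by apply/esym/negP => /imsetP [].
    apply/eqP/imsetP => [e1e|[j _ /Some_inj /(congr1 tag) //]].
    by move: i; rewrite e1e => i; exists i.
  rewrite card_imset ?card_ord // => i j /Some_inj /eqP.
  by rewrite eq_Tagged => /eqP.
have -> : \prod_(e in T) l e = #|pfamily None (mem T) F|.
  rewrite card_pfamily foldrE big_map -big_enum /=.
  by apply: eq_bigr => e _; rewrite cardF.
pose phi (f : {ffun I -> option P}) := [set p | f (tag p) == Some p].
have phiE f p : (p \in phi f) = (f (tag p) == Some p) by rewrite inE.
have pf f : f \in pfamily None (mem T) F ->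
    forall e, if e \in T then exists2 p, f e = Some p & tag p = e else f e = None.
  case/pfamilyP => fT fF e; case: ifP => eT.
    have := fF e eT; rewrite inE; case: (f e) => // p /eqP tp.
    by exists p.
  by apply: (supportP fT); rewrite eT.
rewrite -(card_in_imset (f := phi)) => [|f g /pf fP /pf gP fg].
  apply: eq_card => S; rewrite !inE.
  apply/andP/imsetP => [[/eqP tS /eqP cS]|[f /pf fP ->]].
    exists [ffun e => [pick p in S | tag p == e]].
      apply/pfamilyP; split=> [|e eT].
        apply/supportP => e eT; rewrite ffunE; case: pickP => // p /andP [pS tp].
        by case/negP: eT; rewrite -tS; apply/imsetP; exists p; rewrite ?(eqP tp).
      rewrite ffunE inE; case: pickP => [p /andP [] //|].
      move: eT; rewrite -topredE /= -tS => /imsetP [p pS ->] /(_ p).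
      by rewrite pS eqxx.
    have /imset_injP inj : #|[set tag p | p in S]| == #|S| by rewrite tS cS.
    apply/setP => p; rewrite phiE ffunE; case: pickP => [p' /andP [p'S /eqP tp]|N].
      apply/idP/eqP => [pS|[<- //]]; congr Some; exact: inj.
    by have := N p; rewrite eqxx andbT.
  have inj : {in phi f &, injective (fun p : P => tag p)}.
    move=> p p'; rewrite !phiE => /eqP e1 /eqP e2 tp.
    by move: e1; rewrite tp e2 => -[].
  rewrite -(card_in_imset inj).
  suff -> : [set tag p | p in phi f] = T by [].
  apply/setP => e; have := fP e; case: ifP => [eT [p fe tp]|eT fe].
    by apply/imsetP; exists p; rewrite ?phiE tp ?fe.
  by apply/imsetP => -[p]; rewrite phiE => /eqP fp ee; move: fe; rewrite ee fp.
apply/ffunP => e; have := fP e; have := gP e; case: ifP => eT; last by move=> -> ->.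
case=> p gp tp [p' fp' tp'].
have : p' \in phi f by rewrite phiE tp' fp'.
by rewrite fg phiE tp' fp' => /eqP ->.
Qed.

Lemma card_wsub_edge (D : mgraph) (l : edge D -> nat) :
  #|wsub_edge l| = total_weight l.
Proof.
rewrite card_tagged sumnE big_map big_enum /=.
by apply: eq_bigr => e _; rewrite card_ord.
Qed.

(** A nondisconnecting i-set of the subdivision is obtained by choosing a
    nondisconnecting i-set T of D and one edge on the path of each e in T. *)
Lemma ndisc_wsub (D : mgraph) (l : edge D -> nat) i :
  (forall e, 0 < l e) ->
  ndisc (weak_subdivision l) i
    + \sum_(T : {set edge D} | (#|T| == i) && ~~ disconnecting T)
        \prod_(e in T) l e
  = 'C(total_weight l, i).
Proof.
move=> l_gt0; pose W := weak_subdivision l.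
rewrite -card_wsub_edge -card_draws.
rewrite -(cardsID [set S | disconnecting (S : {set edge W})] [set A : {set wsub_edge l} | #|A| == i]).
congr (_ + _); first by apply: eq_card => S; rewrite !inE.
rewrite -sum1_card.
rewrite (partition_big (fun S : {set wsub_edge l} => [set tag p | p in S])
  (fun T : {set edge D} => (#|T| == i) && ~~ disconnecting T)) /=; last first.
  move=> S; rewrite !inE => /andP [NdS /eqP cS].
  by move: NdS; rewrite (disconnecting_wsub _ l_gt0) negb_or negbK cS.
apply: eq_bigr => T /andP [/eqP cT NdT].
rewrite -card_tag_transversals -sum1_card; apply: eq_bigl => S; rewrite !inE.
apply/andP/andP => [[/eqP tS /eqP cS]|[/andP [NdS cS] tS]].
  by rewrite (disconnecting_wsub (S : {set edge W}) l_gt0) tS cS cT !eqxx orFb NdT.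
by split; [exact: tS | rewrite cT].
Qed.

Lemma ndisc_wsub_disconnecting (D : mgraph) (l : edge D -> nat) i :
  (forall e, 0 < l e) ->
  ndisc (weak_subdivision l) i
    + \sum_(T : {set edge D} | #|T| == i) \prod_(e in T) l e
  = 'C(total_weight l, i)
    + \sum_(T : {set edge D} | (#|T| == i) && disconnecting T)
        \prod_(e in T) l e.
Proof.
move=> l_gt0; rewrite (bigID (@disconnecting D)) /= -(ndisc_wsub i l_gt0).
by rewrite addnCA addnC.
Qed.

(** The i-th elementary symmetric function of n numbers, of which b equal w and
    the others equal q. *)
Definition sym_two_values (w q b n i : nat) : nat :=
  (((1 + w%:P * 'X) ^+ b * (1 + q%:P * 'X) ^+ (n - b) : {poly nat})`_i)%R.

Lemma sum_subsets_two_values (I : finType) (l : I -> nat) (F : {set I})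
    (w q i : nat) :
  (forall e, l e = if e \in F then w else q) ->
  \sum_(T : {set I} | #|T| == i) \prod_(e in T) l e
  = sym_two_values w q #|F| #|I| i.
Proof.
move=> lE; rewrite /sym_two_values.
have -> : ((1 + w%:P * 'X) ^+ #|F| * (1 + q%:P * 'X) ^+ (#|I| - #|F|)
           = \prod_e ((l e)%:P * 'X + 1) :> {poly nat})%R.
  rewrite [RHS](bigID [in F]) /=; congr (_ * _)%R.
    by rewrite -prodr_const; apply: eq_bigr => e eF; rewrite lE eF addrC.
  have -> : #|I| - #|F| = #|~: F| by rewrite [RHS]cardsCs setCK.
  rewrite -prodr_const; apply: eq_big => [e|e]; rewrite inE // => eF.
  by rewrite lE (negPf eF) addrC.
rewrite bigA_distr coef_sum [RHS](bigID (fun T : {set I} => #|T| == i)) /=.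
have termE (T : {set I}) :
    (\prod_e (if e \in T then (l e)%:P * 'X else 1) = (\prod_(e in T) l e)%:P * 'X^#|T| :> {poly nat})%R.
  rewrite -big_mkcond /= big_split /= prodr_const; congr (_ * _)%R.
  by rewrite -rmorph_prod.
rewrite [X in (_ + X)%R]big1 ?addr0; last first.
  by move=> T /negPf cT; rewrite termE coefCM coefXn eq_sym cT mulr0.
by apply: eq_bigr => T /eqP cT; rewrite termE coefCM coefXn cT eqxx mulr1.
Qed.

(** * Three-edge-connected cubic graphs *)

Section CubicGraphs.

Variables (k : nat) (D : mgraph).
Hypotheses (k_ge2 : 2 <= k) (hD : in_Dk k D).

Lemma card_crossing_ge3 (A : {set vert D}) :
  A != set0 -> A != setT -> 3 <= #|crossing A|.
Proof.
have [ec _ _ _] := hD; move=> A0 AT; rewrite leqNgt; apply/negP => lt3; apply: (negP (ec _ lt3)).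
by apply/disconnectingP; exists A.
Qed.

Lemma small_set_neqT (A : {set vert D}) : #|A| <= 2 -> A != setT.
Proof.
have [_ _ cV _] := hD; move=> cA; apply/eqP => AT.
by move: cA; rewrite AT cardsT cV; lia.
Qed.

Lemma card_star_le3 (u : vert D) : #|star u| <= 3.
Proof.
have [_ cub _ _] := hD; rewrite -(cub u) /degree -cardsUI.
apply: leq_trans (leq_addr _ _); apply: subset_leq_card; apply/subsetP => e.
by rewrite !inE.
Qed.

Lemma star_crossing (u : vert D) : star u = crossing [set u].
Proof.
apply/esym/eqP; rewrite eqEcard; apply/andP; split.
  apply/subsetP => e; rewrite !inE /incident.
  by do 2!case: (_ == u).
apply: leq_trans (card_star_le3 u) (card_crossing_ge3 _ _); first by apply/set0Pn; exists u; rewrite inE.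
by apply: small_set_neqT; rewrite cards1.
Qed.

Lemma card_star (u : vert D) : #|star u| = 3.
Proof.
apply/eqP; rewrite eqn_leq card_star_le3 /=.
rewrite star_crossing card_crossing_ge3 ?small_set_neqT ?cards1 //.
by apply/set0Pn; exists u; rewrite inE.
Qed.

Lemma no_loops (e : edge D) : (ends e).1 != (ends e).2.
Proof.
have : e \in star (ends e).1 by rewrite inE /incident eqxx.
by rewrite star_crossing !inE eqxx; apply: contraTneq => <-; rewrite eqxx.
Qed.

(** Two vertices with the same star would form a component of D. *)
Lemma star_inj : injective (@star D).
Proof.
move=> x y sxy; apply/eqP/idPn => xy.
have : 3 <= #|crossing [set x; y]|.
  apply: card_crossing_ge3; first by apply/set0Pn; exists x; rewrite !inE eqxx.
  by apply: small_set_neqT; rewrite cards2; case: eqP.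
rewrite leqNgt => /negP; apply; rewrite [X in #|pred_of_set X|](_ : _ = set0) ?cards0 //.
apply/setP => e; have := no_loops e; have /setP/(_ e) := sxy.
rewrite !inE /incident; move: (ends e) => [a b] /=.
by case: eqVneq => [->|ax]; case: eqVneq => [->|bx] //=;
  rewrite ?eqxx ?(negPf xy) ?[x == a]eq_sym //=; do ?case: eqP => //=.
Qed.

(** The handshake lemma for the subgraph with edge set F. *)
Lemma sum_card_star (F : {set edge D}) : \sum_u #|star u :&: F| = 2 * #|F|.
Proof.
have inc (e : edge D) : \sum_u (incident e u : nat) = 2.
  transitivity #|[set (ends e).1; (ends e).2]|; last by rewrite cards2 no_loops.
  rewrite -sum1_card [RHS]big_mkcond /=; apply: eq_bigr => u _.
  by rewrite !inE /incident ![u == _]eq_sym; case: orP.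
transitivity (\sum_u \sum_(e in F) (incident e u : nat)).
  apply: eq_bigr => u _; rewrite -sum1_card big_mkcond [RHS]big_mkcond /=.
  by apply: eq_bigr => e _; rewrite !inE; do 2!case: ifP => //=; case: incident.
rewrite exchange_big /= (eq_bigr (fun=> 2)) // sum_nat_const; exact: mulnC.
Qed.

Lemma disconnecting_star (u : vert D) : disconnecting (star u).
Proof.
apply/disconnectingP; exists [set u]; rewrite star_crossing; split=> //.
- by apply/set0Pn; exists u; rewrite inE.
- by apply: small_set_neqT; rewrite cards1.
Qed.

Lemma disconnecting3_bond (S : {set edge D}) :
  #|S| = 3 -> is_bond S = disconnecting S.
Proof.
move=> cS; apply/idP/idP.
  case/minsetP => /existsP [A /and3P [A0 AT /eqP ->]] _.
  by apply/disconnectingP; exists A.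
case/disconnectingP => A [A0 AT sub].
have SA : S = crossing A.
  by apply/esym/eqP; rewrite eqEcard sub cS card_crossing_ge3.
apply/minsetP; split; first by apply/existsP; exists A; rewrite A0 AT SA eqxx.
move=> B /existsP [A' /and3P [A'0 A'T /eqP ->]] sub'.
by apply/eqP; rewrite eqEcard sub' cS card_crossing_ge3.
Qed.

(** The disconnecting triples are the stars, which are pairwise different, and the
    nontrivial 3-bonds. *)
Lemma sum_disconnecting3 (l : edge D -> nat) :
  \sum_(T : {set edge D} | (#|T| == 3) && disconnecting T) \prod_(e in T) l e
  = \sum_u \prod_(e in star u) l e
    + \sum_(T : {set edge D} | [&& #|T| == 3, disconnecting T
                                 & T \notin [set star u | u in setT]])
        \prod_(e in T) l e.
Proof.
rewrite (bigID (fun T => T \in [set star u | u in setT])) /=; congr (_ + _).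
  rewrite (eq_bigl (fun T => T \in [set star u | u in setT])) => [|T].
    rewrite big_imset => [|x y _ _ /star_inj //].
    by apply: eq_bigl => u; rewrite inE.
  rewrite andb_idl // => /imsetP [u _ ->].
  by rewrite card_star disconnecting_star.
by apply: eq_bigl => T; rewrite andbA.
Qed.

Lemma sum_disconnecting3_eq (l : edge D -> nat) :
  (forall e, 0 < l e) ->
  \sum_(T : {set edge D} | (#|T| == 3) && disconnecting T) \prod_(e in T) l e
    = \sum_u \prod_(e in star u) l e
  <-> trivial_3bonds D.
Proof.
move=> l_gt0; rewrite sum_disconnecting3; split.
  move/eqP; rewrite -[X in _ == X]addn0 eqn_add2l sum_nat_eq0 => /forallP h S bS cS.
  have := h S; rewrite -disconnecting3_bond // cS eqxx bS /=.
  case: imsetP => [[u _ ->] _|_ /=]; first by exists u.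
  by rewrite eqn0Ngt prodn_gt0.
move=> triv; rewrite [X in _ + X]big_pred0 ?addn0 // => T.
apply/negP => /and3P [/eqP cT]; rewrite -disconnecting3_bond // => bT.
by have [u ->] := triv T bT cT; rewrite imset_f.
Qed.

End CubicGraphs.

(** * The convexity bound on the sum over stars *)

(** The product of the weights of the three edges at a vertex, when j of them
    have weight w and the others weight q. *)
Definition star_prod (q w : int) (j : nat) : int := (q ^+ (3 - j) * w ^+ j)%R.

(** The value at j of the chord of [star_prod] through a and a.+1. *)
Definition chord (q w : int) (a : nat) (j : int) : int :=
  (star_prod q w a + (j - a%:Z) * (star_prod q w a.+1 - star_prod q w a))%R.

(** Strict convexity of [star_prod]: at the integers 0, ..., 3 its values lie above
    the chord, except for equality at the two ends a and a.+1.  Only the chords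
    with a <= 1 are needed, as the mean of j is at most 3/2. *)
Lemma chord_le (q w : int) a j :
  (0 < q -> 0 < w -> w != q -> (a <= 1)%N -> (j <= 3)%N ->
   chord q w a j%:Z <= star_prod q w j
     ?= iff ((j == a) || (j == a.+1)))%R.
Proof.
move=> q0 w0 wq a1 j3.
have d2 : (0 < (w - q) ^+ 2)%R by rewrite exprn_even_gt0 //= subr_eq0.
have q3 : (0 < q * (w - q) ^+ 2)%R by exact: mulr_gt0.
have w3 : (0 < w * (w - q) ^+ 2)%R by exact: mulr_gt0.
rewrite /chord /star_prod; apply/leifP.
move: a j a1 j3 => [|[|//]] [|[|[|[|//]]]] _ _ /=;
  rewrite ?subSS ?subn0 ?expr0 ?mulr1 ?mul1r; try (apply/eqP; ring); nia.
Qed.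

(** The left-hand side is the sum over all vertices of the chord through
    [b %/ k] and its successor, the integers around the mean of [j]. *)
Lemma sum_star_prod (V : finType) (j : V -> nat) (q w : int) (k b : nat) :
  0 < k -> (0 < q)%R -> (0 < w)%R -> w != q ->
  #|V| = 2 * k -> (forall u, j u <= 3) -> \sum_u j u = 2 * b -> 2 * b <= 3 * k ->
  ((2 * k)%:Z * chord q w (b %/ k) 0
     + (2 * b)%:Z * (star_prod q w (b %/ k).+1 - star_prod q w (b %/ k))
   <= \sum_u star_prod q w (j u)
     ?= iff [forall u, forall v, (j u <= (j v).+1)%N])%R.
Proof.
move=> k0 q0 w0 wq cV j3 sj b3.
set a := b %/ k.
have abk : a * k <= b < a.+1 * k by rewrite leq_divM ltn_ceil.
have a1 : a <= 1 by rewrite -ltnS ltn_divLR //; lia.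
have -> : ((2 * k)%:Z * chord q w a 0
     + (2 * b)%:Z * (star_prod q w a.+1 - star_prod q w a)
   = \sum_u chord q w a (j u)%:Z)%R.
  rewrite /chord big_split /= -[X in (_ = _ + X)%R]mulr_suml sumrB !sumr_const cV -(mulr_natl (star_prod q w a)) -(mulr_natl a%:Z)%R.
  rewrite -sj !natz -(rmorph_sum Posz) /=; ring.
have -> : [forall u, forall v, j u <= (j v).+1]
          = [forall u, (j u == a) || (j u == a.+1)].
  apply/forallP/forallP => [bal u|h u]; last first.
    apply/forallP => v.
    by case/orP: (h u) => /eqP ->; case/orP: (h v) => /eqP ->; lia.
  have jle v : j u <= (j v).+1 by have /forallP := bal u; apply.
  have jge v : j v <= (j u).+1 by have /forallP := bal v; apply.
  (* the mean of j lies in the interval from a to a.+1, excluding a.+1 *)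
  apply/idPn; rewrite negb_or => /andP [ja ja1].
  have [lt|ge] := ltnP (j u) a.
    have : \sum_v j v < \sum_(v : V) a.
      rewrite (bigD1 u) //= [ltnRHS](bigD1 u) //=.
      rewrite -addSn leq_add // leq_sum // => v _.
      by apply: leq_trans (jge v) _.
    by rewrite sj sum_nat_const cV; lia.
  have : \sum_(v : V) a.+1 <= \sum_v j v.
    by apply: leq_sum => v _; have := jle v; lia.
  by rewrite sj sum_nat_const cV; lia.
by apply: leif_sum => u _; apply: chord_le.
Qed.

(** * The minimum number of disconnecting triples *)

(** The weights are q and w, and exactly b edges have weight w. *)
Definition two_valued (D : mgraph) (l : edge D -> nat) (q w b : nat) : Prop :=
  (forall e, l e = q \/ l e = w) /\ #|[set e | l e == w]| = b.

(** The number of disconnecting triples of the subdivision when all 3-bonds are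
    stars and the b edges of weight w are spread evenly over the vertices. *)
Definition min_ndisc3 (k m q w b : nat) : int :=
  ('C(m, 3)%:Z
   - (sym_two_values w q b (3 * k) 3)%:Z
   + ((2 * k)%:Z * chord q%:Z w%:Z (b %/ k) 0
      + (2 * b)%:Z * (star_prod q%:Z w%:Z (b %/ k).+1
                      - star_prod q%:Z w%:Z (b %/ k))))%R.

Lemma prod_star_two_valued (D : mgraph) (l : edge D -> nat) q w b (u : vert D) :
  two_valued l q w b -> #|star u| = 3 ->
  Posz (\prod_(e in star u) l e)
  = star_prod (Posz q) (Posz w) #|star u :&: [set e | l e == w]|.
Proof.
case=> lE _ c3; rewrite /star_prod -c3.
have -> : #|star u| - #|star u :&: [set e | l e == w]|
          = #|star u :\: [set e | l e == w]| by rewrite -(cardsID [set e | l e == w] (star u)) addKn.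
rewrite (big_setID [set e | l e == w]) /= PoszM mulrC; congr (_ * _)%R.
  rewrite (eq_bigr (fun=> q)) => [|e]; first by rewrite prod_nat_const -rmorphXn.
  by rewrite !inE => /andP [/eqP lw _]; case: (lE e).
rewrite (eq_bigr (fun=> w)) => [|e]; first by rewrite prod_nat_const -rmorphXn.
by rewrite !inE => /andP [_ /eqP].
Qed.

Lemma min_ndisc3_le (k m q w b : nat) (D : mgraph) (l : edge D -> nat) :
  2 <= k -> 0 < q -> 0 < w -> w != q -> 2 * b <= 3 * k ->
  in_Dk k D -> two_valued l q w b -> total_weight l = m ->
  (min_ndisc3 k m q w b <= (ndisc (weak_subdivision l) 3)%:Z)%R
  /\ (min_ndisc3 k m q w b = Posz (ndisc (weak_subdivision l) 3)
      <-> trivial_3bonds D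
          /\ forall u v : vert D, #|star u :&: [set e | l e == w]|
                                  <= #|star v :&: [set e | l e == w]|.+1).
Proof.
move=> k2 q0 w0 wq b3 hD lv lm.
have [_ _ cV cE] := hD; have [lE cF] := lv.
have l_gt0 e : 0 < l e by case: (lE e) => ->.
pose F := [set e | l e == w].
have := ndisc_wsub_disconnecting 3 l_gt0.
rewrite (@sum_subsets_two_values _ l F w q 3) => [|e]; last first.
  by rewrite inE; case: eqP => // ne; case: (lE e).
rewrite lm cF cE => eqn.
have eqs := sum_disconnecting3_eq k2 hD l_gt0.
have les : \sum_u \prod_(e in star u) l e <=
  \sum_(T : {set edge D} | (#|T| == 3) && disconnecting T) \prod_(e in T) l e.
  by rewrite (sum_disconnecting3 k2 hD l) leq_addr.
have cs := card_star k2 hD.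
have j3 (u : vert D) : #|star u :&: F| <= 3.
  by rewrite -(cs u) subset_leq_card // subsetIl.
have sj : \sum_(u : vert D) #|star u :&: F| = 2 * b.
  by rewrite (sum_card_star k2 hD) cF.
have [] := sum_star_prod (w := Posz w) (q := Posz q) (ltnW k2) q0 w0 wq cV j3 sj b3.
have -> : (\sum_u star_prod q%:Z w%:Z #|star u :&: F|
          = Posz (\sum_u \prod_(e in star u) l e)%N)%R.
  rewrite (rmorph_sum Posz) /=; apply: eq_bigr => u _.
  by rewrite -(prod_star_two_valued lv (cs u)).
move=> lec eqc.
have balP : reflect (forall u v : vert D, #|star u :&: F| <= #|star v :&: F|.+1)
   [forall u : vert D, forall v, #|star u :&: F| <= #|star v :&: F|.+1].
  apply: (iffP forallP) => [h u v|h u]; first by have /forallP := h u; apply.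
  by apply/forallP => v; apply: h.
rewrite /min_ndisc3; split; first lia.
split=> [h|[/eqs h1 /balP h2]].
  split; first by apply/eqs; lia.
  by apply/balP; rewrite -eqc; apply/eqP; lia.
by move: h2; rewrite -eqc => /eqP; lia.
Qed.

(** * Balanced weightings *)

(** The weight other than q that occurs in a balanced weighting of total weight
    N q + r (for r = 0 it does not occur). *)
Definition other_weight (q r : int) : int :=
  (if 0 <= r then q + 1 else q - 1)%R.

Lemma balanced_values (D : mgraph) (l : edge D -> nat) (q r : int) :
  0 < #|edge D| -> balanced l ->
  ((total_weight l)%:Z = #|edge D|%:Z * q + r)%R ->
  (- #|edge D|%:Z < 2 * r <= #|edge D|%:Z)%R ->
  (forall e, Posz (l e) = q \/ Posz (l e) = other_weight q r)
  /\ #|[set e | Posz (l e) == other_weight q r]| = `|r|%N.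
Proof.
move=> N0 bal lm hr.
have /card_gt0P [e1 _] := N0.
case: (arg_minnP l (erefl : xpredT e1)) => e0 _ mine0.
have val e : l e = l e0 \/ l e = (l e0).+1.
  by have := mine0 e isT; have := bal e e0; lia.
pose c := #|[set e | l e == (l e0).+1]|.
have cN : c + #|[set e | l e == l e0]| = #|edge D|.
  rewrite -(cardsC [set e | l e == (l e0).+1]); congr (_ + _).
  by apply: eq_card => e; rewrite !inE; have := val e; lia.
have c0 : 0 < #|[set e | l e == l e0]|.
  by apply/card_gt0P; exists e0; rewrite inE.
have lmc : total_weight l = #|edge D| * l e0 + c.
  have -> : c = \sum_e (l e == (l e0).+1) by rewrite /c -sum1dep_card big_mkcond.
  rewrite /total_weight -sum_nat_const -big_split /=.
  by apply: eq_bigr => e _; have := val e; case: eqP; lia.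
rewrite /other_weight; move: lm; rewrite lmc => lm.
have [r0|r0] := lerP 0 r.
  have qE : q = Posz (l e0) by nia.
  split=> [e|]; first by have := val e; lia.
  rewrite (_ : `|r|%N = c); last by rewrite qE in lm; lia.
  by apply: eq_card => e; rewrite !inE; lia.
have qE : q = ((l e0)%:Z + 1)%R by nia.
split=> [e|]; first by have := val e; lia.
rewrite (_ : `|r|%N = #|[set e | l e == l e0]|); last by rewrite qE in lm; nia.
by apply: eq_card => e; rewrite !inE; lia.
Qed.

(** The value |pi^v(u)| is the number of edges at u of weight [other_weight q r],
    and all the values pi^v(u) have the same sign. *)
Lemma piv_balanced_card (D : mgraph) (l : edge D -> nat) (q r : int) :
  (forall e, Posz (l e) = q \/ Posz (l e) = other_weight q r) ->
  piv_balanced l q <->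
  forall u v : vert D, #|star u :&: [set e | Posz (l e) == other_weight q r]|
                  <= #|star v :&: [set e | Posz (l e) == other_weight q r]|.+1.
Proof.
move=> lE.
have pivE u : piv l q u =
    ((if 0 <= r then 1 else -1)
     * #|star u :&: [set e | Posz (l e) == other_weight q r]|%:Z)%R.
  rewrite /piv /other_weight; case: ifP => r0.
    rewrite mul1r [X in (_ - X%:Z)%R](_ : _ = 0) ?subr0; last first.
      apply: eq_card0 => e; rewrite !inE; apply/negP => /andP [_].
      by have := lE e; rewrite /other_weight r0; lia.
    by congr Posz; apply: eq_card => e; rewrite !inE.
  rewrite mulN1r [X in (X%:Z - _)%R](_ : _ = 0) ?sub0r; last first.
    apply: eq_card0 => e; rewrite !inE; apply/negP => /andP [_].
    by have := lE e; rewrite /other_weight r0; lia.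
  by congr (- Posz _)%R; apply: eq_card => e; rewrite !inE.
split=> h u v; last by have := h u v; have := h v u; rewrite !pivE; case: ifP; lia.
by have := h u v; rewrite !pivE; case: ifP; lia.
Qed.

(** * Möbius ladders *)

Lemma sum_rotate (n s : nat) (f : nat -> nat) :
  (forall i, f (i + n) = f i) -> \sum_(i < n) f (s + i) = \sum_(i < n) f i.
Proof.
move=> per; elim: s => [|s IHs]; first by apply: eq_bigr => i _.
rewrite -{}IHs; case: n per => [|n] per; first by rewrite !big_ord0.
rewrite big_ord_recr [RHS]big_ord_recl /= addn0 addnC.
congr (_ + _); first by rewrite addSn -addnS per.
by apply: eq_bigr => i _; rewrite addSn -addnS.
Qed.

Lemma sum_halves (k : nat) (f : nat -> nat) :
  \sum_(j < k) f j + \sum_(j < k) f (j + k) = \sum_(i < 2 * k) f i.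
Proof.
rewrite mul2n -addnn big_split_ord /=; congr (_ + _).
by apply: eq_bigr => j _; rewrite addnC.
Qed.

Lemma sum_andb_eq (n x : nat) (P : pred nat) :
  x < n -> \sum_(i < n) (P i && (i == x :> nat) : nat) = P x.
Proof.
move=> xn; rewrite (bigD1 (Ordinal xn)) //= eqxx andbT big1 ?addn0 // => i.
by rewrite -val_eqE /= => /negPf ->; rewrite andbF.
Qed.

Lemma sum_ltn (n a : nat) : \sum_(i < n) (i < a : nat) = minn a n.
Proof.
by elim: n => [|n IHn]; [rewrite big_ord0 minn0 | rewrite big_ord_recr /= IHn; lia].
Qed.

Lemma sum_geq (n a : nat) : \sum_(i < n) (a <= i : nat) = n - a.
Proof.
by elim: n => [|n IHn]; [rewrite big_ord0 | rewrite big_ord_recr /= IHn; lia].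
Qed.

Lemma sum_even_ltn (k c : nat) :
  \sum_(i < 2 * k) (~~ odd i && (i./2 < c) : nat) = minn c k.
Proof.
elim: k => [|k IHk]; first by rewrite big_ord0 minn0.
rewrite mulnS !big_ord_recr /= IHk mul2n doubleK /= odd_double /=.
by rewrite addn0; lia.
Qed.

(** The numbers of edges of the cycle on the integers mod 2k, respectively of
    pairs of opposite integers mod 2k, whose ends have different colours under
    chi. *)
Definition rim_changes (k : nat) (chi : nat -> bool) : nat :=
  \sum_(i < 2 * k) (chi i != chi i.+1 : nat).
Definition rung_changes (k : nat) (chi : nat -> bool) : nat :=
  \sum_(j < k) (chi j != chi (j + k) : nat).

Lemma seg_changes (psi : nat -> bool) a b :
  a <= b -> psi a != psi b -> 0 < \sum_(a <= i < b) (psi i != psi i.+1 : nat).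
Proof.
move=> ab /(change_step ab) [i [ai ib ne]].
rewrite (@big_cat_nat _ _ _ i) //=; last exact: ltnW.
by rewrite [X in _ + X]big_ltn // ne; lia.
Qed.

(** With at most three rim changes, one of the colours occupies an arc, which
    gives min(a, 2k - a) rung changes for an arc of length a.  So there are at
    least three changes, and with exactly three of them the arc is a single
    vertex or misses a single vertex. *)
Lemma ladder_changes (k : nat) (chi : nat -> bool) :
  0 < k -> (forall i, chi (i + 2 * k) = chi i) -> (exists i j, chi i != chi j) ->
  3 <= rim_changes k chi + rung_changes k chi
  /\ (rim_changes k chi + rung_changes k chi = 3 ->
      exists s, forall j, 0 < j < 2 * k -> chi (s + j) = ~~ chi s).
Proof.
move=> k0 per [x [y ij]].
have [s1 ne1] : exists s, chi s != chi s.+1.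
  wlog ij_le : x y ij / x <= y.
    by move=> wl; case: (leqP x y) => [/wl|/ltnW/wl]; apply; rewrite // eq_sym.
  by have [s [_ _ ne]] := change_step ij_le ij; exists s.
(* the colouring rotated so that it changes from position -1 to position 0 *)
pose psi t := chi (s1.+1 + t).
have perpsi t : psi (t + 2 * k) = psi t by rewrite /psi addnA per.
have wrap : psi (2 * k).-1 != psi 0.
  rewrite /psi addn0 (_ : s1.+1 + (2 * k).-1 = s1 + 2 * k); last by lia.
  by rewrite per.
have rimE : rim_changes k chi = rim_changes k psi.
  rewrite /rim_changes -(@sum_rotate _ s1.+1 (fun i => chi i != chi i.+1 : nat)).
    by apply: eq_bigr => t _; rewrite /psi addnS.
  by move=> t; rewrite -addSn !per.
have rungE : rung_changes k chi = rung_changes k psi.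
  rewrite /rung_changes -(@sum_rotate _ s1.+1 (fun i => chi i != chi (i + k) : nat)).
    by apply: eq_bigr => t _; rewrite /psi addnA.
  by move=> t; rewrite -addnA addnn -mul2n per eq_sym.
have ex : exists t, psi t != psi 0 by exists (2 * k).-1.
(* the first arc of constant colour occupies the positions 0, ..., a.-1 *)
case: (ex_minnP ex) => a ane amin.
have a0 : 0 < a by case: a ane {amin} => //; rewrite eqxx.
have a2k : a <= (2 * k).-1 by apply: amin.
have before t : t < a -> psi t = psi 0.
  by move=> ta; apply/eqP; apply: contraLR ta => /amin; rewrite -leqNgt.
have seg1 : 0 < \sum_(0 <= i < a) (psi i != psi i.+1 : nat).
  by apply: seg_changes => //; rewrite eq_sym.
have seg4 : 0 < \sum_((2 * k).-1 <= i < 2 * k) (psi i != psi i.+1 : nat).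
  by apply: seg_changes; [lia | rewrite -[2 * k]add0n perpsi add0n].
have split3 : rim_changes k psi = \sum_(0 <= i < a) (psi i != psi i.+1 : nat)
   + \sum_(a <= i < (2 * k).-1) (psi i != psi i.+1 : nat)
   + \sum_((2 * k).-1 <= i < 2 * k) (psi i != psi i.+1 : nat).
  rewrite /rim_changes -(big_mkord xpredT (fun i => psi i != psi i.+1 : nat)).
  by rewrite -!big_cat_nat //; lia.
rewrite rimE rungE.
have [le3|gt3] := leqP (rim_changes k psi) 3; last by split; lia.
have after t : a <= t < 2 * k -> psi t = ~~ psi 0.
  move=> /andP [a_t t2k]; have [tE|] := eqVneq (psi t) (psi 0); last first.
    by case: (psi t) (psi 0) => -[].
  (* a change back before t would give two more rim changes *)
  have [ta tlast] : t != a /\ t != (2 * k).-1.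
    by split; apply/eqP => tt; [move: ane | move: wrap]; rewrite -tt tE eqxx.
  have : 0 < \sum_(a <= i < t) (psi i != psi i.+1 : nat).
    by apply: seg_changes => //; rewrite tE.
  have : 0 < \sum_(t <= i < (2 * k).-1) (psi i != psi i.+1 : nat).
    by apply: seg_changes; [lia | rewrite tE eq_sym].
  move: le3; rewrite split3 (@big_cat_nat _ _ _ t a) //=; lia.
have rungs : rung_changes k psi = minn a (2 * k - a).
  rewrite /rung_changes; have [ak|ka] := leqP a k.
    rewrite (eq_bigr (fun j : 'I_k => (j < a : nat))) ?sum_ltn; first lia.
    move=> j _; have := ltn_ord j => jk.
    rewrite (after (j + k)); last by lia.
    case: ltnP => ja; first by rewrite before //; case: (psi 0).
    by rewrite (after j) ?eqxx //; lia.
  rewrite (eq_bigr (fun j : 'I_k => (a - k <= j : nat))) ?sum_geq; first lia.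
  move=> j _; have := ltn_ord j => jk.
  rewrite (before j); last by lia.
  case: leqP => ja; first by rewrite (after (j + k)); [case: (psi 0) | lia].
  by rewrite (before (j + k)) ?eqxx //; lia.
split; first by rewrite rungs; lia.
rewrite rungs => N3.
have [a1|a2] : a = 1 \/ a = (2 * k).-1 by lia.
  exists s1.+1 => j /andP [j0 j2k]; rewrite -[in RHS](addn0 s1.+1).
  by apply: after; rewrite a1 j0.
exists (s1.+1 + (2 * k).-1) => j /andP [j0 j2k].
rewrite -/(psi _) after ?negbK; last by lia.
rewrite (_ : _ + j = s1.+1 + j.-1 + 2 * k); last by lia.
by rewrite per; apply: before; lia.
Qed.

Section Ladder.

Variables (k : nat) (k2_gt0 : 0 < 2 * k).

(** The rim vertex numbered i mod 2k. *)
Definition rim (i : nat) : 'I_(2 * k) := Ordinal (ltn_pmod i k2_gt0).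

(** The Möbius ladder: a cycle on 2k vertices, its rim, together with the k
    rungs that join opposite vertices. *)
Definition ladder_ends (e : 'I_(2 * k) + 'I_k) : 'I_(2 * k) * 'I_(2 * k) :=
  match e with
  | inl i => (rim i, rim i.+1)
  | inr j => (rim j, rim (j + k))
  end.

Definition ladder : mgraph := MGraph ladder_ends.

Lemma rim_id (x : 'I_(2 * k)) : rim x = x.
Proof. by apply: val_inj; rewrite /= modn_small. Qed.

Lemma rim_period i : rim (i + 2 * k) = rim i.
Proof. by apply: val_inj; rewrite /= modnDr. Qed.

Lemma card_ladder_edges (P : pred (edge ladder)) :
  #|[set e | P e]| = \sum_(i < 2 * k) P (inl i) + \sum_(j < k) P (inr j).
Proof.
rewrite -sum1dep_card big_mkcond big_sumType /=.
by congr (_ + _); apply: eq_bigr => i _; case: (P _).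
Qed.

Lemma rim_eq (i : nat) (x : 'I_(2 * k)) : i < 2 * k -> (rim i == x) = (i == x).
Proof. by move=> i2k; rewrite -val_eqE /= modn_small. Qed.

Lemma cubic_ladder : cubic ladder.
Proof.
move=> x; rewrite /degree.
have setE (P : pred (edge ladder)) : [set e in setT | P e] = [set e | P e].
  by apply/setP => e; rewrite !inE.
rewrite !setE !card_ladder_edges /= addnACA.
have x2k : x < 2 * k := ltn_ord x.
have one : \sum_(i < 2 * k) (rim i == x : nat) = 1.
  rewrite -[RHS](sum_andb_eq xpredT x2k); apply: eq_bigr => i _.
  by rewrite rim_eq.
rewrite one (@sum_rotate _ 1 (fun i => (rim i == x : nat))) ?one; last first.
  by move=> i; rewrite rim_period.
suff -> : \sum_(j < k) (rim j == x : nat) + \sum_(j < k) (rim (j + k) == x : nat) = 1.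
  by [].
by rewrite (sum_halves k (fun j => (rim j == x : nat))).
Qed.

Lemma card_crossing_ladder (A : {set vert ladder}) :
  #|crossing A| = rim_changes k (fun i => rim i \in A)
                + rung_changes k (fun i => rim i \in A).
Proof. by rewrite card_ladder_edges. Qed.

Lemma ladder_nonconstant (A : {set vert ladder}) :
  A != set0 -> A != setT -> exists i j, (rim i \in A) != (rim j \in A).
Proof.
case/set0Pn => x xA; rewrite -subTset => /subsetPn [y _ yA].
by exists x, y; rewrite !rim_id xA (negPf yA).
Qed.

Lemma in_Dk_ladder : in_Dk k ladder.
Proof.
split.
- move=> S S3; apply/negP => /disconnectingP [A [A0 AT sub]].
  have [] := @ladder_changes k (fun i => rim i \in A).
  + by lia.
  + by move=> i; rewrite rim_period.
  + exact: ladder_nonconstant.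
  rewrite -card_crossing_ladder => + _.
  by have := subset_leq_card sub; lia.
- exact: cubic_ladder.
- by rewrite card_ord.
- by rewrite card_sum !card_ord; lia.
Qed.

Lemma trivial_3bonds_ladder : 2 <= k -> trivial_3bonds ladder.
Proof.
move=> k2 S /minsetP [/existsP [A /and3P [A0 AT /eqP SA]] _] cS.
have [] := @ladder_changes k (fun i => rim i \in A).
- by lia.
- by move=> i; rewrite rim_period.
- exact: ladder_nonconstant.
rewrite -card_crossing_ladder -SA cS => _ [//|s single].
exists (rim s); rewrite (star_crossing k2 in_Dk_ladder) SA.
have inA x : (x \in A) = ((rim s \in A) == (x == rim s)).
  have [->|xs] := eqVneq x (rim s); first by case: (_ \in _).
  have [d [d0 dE]] : exists d, 0 < d < 2 * k /\ rim (s + d) = x.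
    exists ((x + (2 * k - s %% (2 * k))) %% (2 * k)); split.
      rewrite ltn_pmod // andbT lt0n; apply: contraNneq xs => h.
      apply/eqP/val_inj => /=; have := ltn_ord x; have := ltn_pmod s k2_gt0.
      move/eqP: h; rewrite -/(dvdn _ _) => /dvdnP [t].
      move: (s %% (2 * k)) (nat_of_ord x) => a c ht a_lt c_lt.
      have t1 : t = 1 by nia.
      by move: ht; rewrite t1; lia.
    apply: val_inj; rewrite /= modnDmr addnCA -modnDmr -(modnDml s) subnKC.
      by rewrite modnn addn0 modn_small.
    exact/ltnW/ltn_pmod.
  by rewrite -dE single //; case: (_ \in _).
apply/setP => e; rewrite !inE (inA (ladder_ends e).1) (inA (ladder_ends e).2).
by case: (rim s \in A); case: (_ == rim s); case: (_ == rim s).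
Qed.

End Ladder.

(** * Evenly spread weights on a Möbius ladder *)

Section LadderWeighting.

Variables (k : nat) (k2_gt0 : 0 < 2 * k).

Local Notation ladder := (ladder k2_gt0).

(** An enumeration of the rungs followed by every other edge of the rim: both
    families are perfect matchings.  The remaining rim edges get the rank 3k, beyond
    the numbers b of special edges that occur. *)
Definition ladder_rank (e : edge ladder) : nat :=
  match e with
  | inl i => if odd i then 3 * k else k + i./2
  | inr j => j
  end.

Definition ladder_special (b : nat) : {set edge ladder} :=
  [set e | ladder_rank e < b].

Lemma card_ladder_special b : 2 * b <= 3 * k -> #|ladder_special b| = b.
Proof.
move=> b3; rewrite card_ladder_edges /= sum_ltn.
rewrite (eq_bigr (fun i : 'I_(2 * k) => (~~ odd i && (i./2 < b - k) : nat))).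
  by rewrite sum_even_ltn; lia.
by move=> i _; congr nat_of_bool; case: (odd i) => /=; lia.
Qed.

(** The two summands tell whether the rim edge, respectively the rung, that is
    enumerated at u is special. *)
Lemma card_star_special b (u : vert ladder) : 2 * b <= 3 * k ->
  #|star u :&: ladder_special b| = (k + u./2 < b) + (u %% k < b).
Proof.
move=> b3; have k0 : 0 < k by lia.
have u2k : u < 2 * k := ltn_ord u.
have -> : star u :&: ladder_special b
          = [set e | incident e u && (ladder_rank e < b)].
  by apply/setP => e; rewrite !inE.
rewrite card_ladder_edges; congr (_ + _).
  have e2k : u./2.*2 < 2 * k by lia.
  rewrite -[in RHS](doubleK u./2) -(sum_andb_eq (fun i => k + i./2 < b) e2k).
  apply: eq_bigr => i _; congr nat_of_bool; rewrite /incident /=.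
  have i2k := ltn_ord i; case: ifP => oi.
    have -> : (i == u./2.*2 :> nat) = false by lia.
    by rewrite andbF; lia.
  rewrite !rim_eq //; last by lia.
  by rewrite andbC; congr (_ && _); lia.
have uk := ltn_pmod u k0.
rewrite -(sum_andb_eq (fun j => j < b) uk); apply: eq_bigr => j _.
congr nat_of_bool; rewrite /incident /= andbC; congr (_ && _).
have jk := ltn_ord j.
rewrite !rim_eq; [|by lia|by lia].
have [uk'|ku] := ltnP u k; first by rewrite modn_small //; lia.
by rewrite -[in RHS](subnK ku) modnDr modn_small; lia.
Qed.

Lemma card_star_special_balanced b (u v : vert ladder) : 2 * b <= 3 * k ->
  #|star u :&: ladder_special b| <= #|star v :&: ladder_special b|.+1.
Proof.
move=> b3; rewrite !card_star_special //.
have k0 : 0 < k by lia.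
by have := ltn_pmod u k0; have := ltn_pmod v k0; lia.
Qed.

End LadderWeighting.

Lemma total_two_valued (D : mgraph) (l : edge D -> nat) q w b :
  w != q -> two_valued l q w b ->
  total_weight l = b * w + (#|edge D| - b) * q.
Proof.
move=> wq [lE cF]; rewrite /total_weight (bigID [in [set e | l e == w]]) /=.
congr (_ + _).
  rewrite (eq_bigr (fun=> w)) => [|e]; last by rewrite inE => /eqP.
  by rewrite sum_nat_const cF.
rewrite (eq_bigr (fun=> q)) => [|e]; last by rewrite inE; case: (lE e) => // ->; rewrite eqxx.
rewrite sum_nat_const -cF; congr (_ * _).
by rewrite -(cardC [in [set e | l e == w]]) addKn; apply: eq_card.
Qed.

(** Weighting a Möbius ladder so that the edges of weight w are spread evenly. *)
Lemma exists_extremal (k q w b : nat) :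
  2 <= k -> w != q -> 2 * b <= 3 * k ->
  exists (D : mgraph) (l : edge D -> nat),
    [/\ in_Dk k D, two_valued l q w b, trivial_3bonds D
      & forall u v : vert D, #|star u :&: [set e | l e == w]|
                             <= #|star v :&: [set e | l e == w]|.+1].
Proof.
move=> k2 wq b3; have k2_gt0 : 0 < 2 * k by lia.
exists (ladder k2_gt0), (fun e => if e \in ladder_special k2_gt0 b then w else q).
have -> : [set e | (if e \in ladder_special k2_gt0 b then w else q) == w]
          = ladder_special k2_gt0 b.
  by apply/setP => e; rewrite !inE; case: ifP; rewrite ?eqxx // eq_sym (negPf wq).
split.
- exact: in_Dk_ladder.
- split=> [e|]; first by case: ifP; [right | left].
  rewrite -[RHS](card_ladder_special k2_gt0 b3); apply: eq_card => e.
  by rewrite !inE; case: ifP; rewrite ?eqxx // eq_sym (negPf wq).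
- exact: trivial_3bonds_ladder.
- by move=> u v; apply: card_star_special_balanced.
Qed.

(** * The minimizers *)

Lemma mgraph_iso_refl (G : mgraph) : mgraph_iso G G.
Proof.
exists id, id; split; [by exists id|by exists id|] => e.
by rewrite /joins -surjective_pairing eqxx.
Qed.

Theorem theorem6p3 (k m : nat) (hk : 2 <= k) (hm : 3 * k <= m)
  (q r : int) (hqr : (m%:Z = (3 * k)%:Z * q + r)%R)
  (hr : (- (3 * k)%:Z < 2 * r <= (3 * k)%:Z)%R)
  (D : mgraph) (hD : in_Dk k D)
  (l : edge D -> nat) (hl : is_weighting l) (hb : balanced l)
  (hm_tot : total_weight l = m)
  (G : mgraph) (hG : mgraph_iso (weak_subdivision l) G) :
  (minimizes (fun H => ndisc H 3) (in_BDk m k) G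
     <-> trivial_3bonds D /\ piv_balanced l q)
  /\ (3 * k %| m -> piv_balanced l q).
Proof.
have q0 : (0 < q)%R by nia.
have w0 : (0 < other_weight q r)%R.
  rewrite /other_weight; case: (lerP 0 r) => r0; first lia.
  have [q1|] : q = 1%R \/ (1 < q)%R by lia.
    by move: hqr; rewrite q1; lia.
  by lia.
have wq' : other_weight q r != q by rewrite /other_weight; case: ifP; lia.
case qE : q q0 => [Q|//] Q0.
case wE : (other_weight q r) w0 => [w|//] w0.
have wq : w != Q by move: wq'; rewrite wE qE.
(* |w - q| = 1 *)
have dist : w <= Q.+1 /\ Q <= w.+1.
  by move: wE; rewrite /other_weight; case: ifP; lia.
pose b := `|r|%N.
have b3 : 2 * b <= 3 * k by rewrite /b; lia.
(* all balanced weightings of total weight m have the same two values, with the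
   same multiplicities *)
have values D' (l' : edge D' -> nat) :
    in_Dk k D' -> balanced l' -> total_weight l' = m -> two_valued l' Q w b.
  case=> _ _ _ cE' bal' tot'.
  have [|||lE cF] := @balanced_values D' l' q r _ bal'; rewrite ?cE' ?tot' //; first by lia.
  split=> [e|]; first by have := lE e; rewrite wE qE => -[[->]|[->]]; [left|right].
  by rewrite -[RHS]cF wE; apply: eq_card => e; rewrite !inE.
have lv := values D l hD hb hm_tot.
have pivP : piv_balanced l q <->
    forall u v : vert D, #|star u :&: [set e | l e == w]|
                         <= #|star v :&: [set e | l e == w]|.+1.
  have [|||lE _] := @balanced_values D l q r _ hb; rewrite ?hm_tot ?(let: And4 _ _ _ h := hD in h) //; first by lia.
  rewrite (piv_balanced_card lE) wE.
  by rewrite (_ : [set e | _] = [set e | l e == w]) //; apply/setP => e; rewrite !inE.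
have bound D' l' hD' lv' tot' :=
  @min_ndisc3_le k m Q w b D' l' hk Q0 w0 wq b3 hD' lv' tot'.
have inBG : in_BDk m k G by exists D; split=> //; exists l.
rewrite -qE; split; last first.
  move=> /dvdnP [t mt]; apply/pivP => u v.
  have r0 : r = 0%R.
    have : ((3 * k)%:Z * (t%:Z - q) = r)%R.
      by move: hqr; rewrite mt PoszM [(t%:Z * _)%R]mulrC mulrBr => ->; ring.
    have N0 : (0 < (3 * k)%:Z :> int)%R by lia.
    move: hr N0; move: (3 * k)%:Z%R (t%:Z - q)%R => N d hr' N0 Nd.
    have [d1|[d1|d1]] : (d <= -1 \/ d = 0 \/ 1 <= d)%R by lia.
    - by nia.
    - by move: Nd; rewrite d1 mulr0.
    - by nia.
  have F0 : [set e | l e == w] = set0.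
    by apply/eqP; rewrite -cards_eq0 (proj2 lv) /b r0.
  by rewrite F0 !setI0 cards0.
have [leG eqG] := bound D l hD lv hm_tot.
split=> [[_ minG]|[triv /pivP bal]].
- have [D1 [l1 [hD1 lv1 triv1 bal1]]] := exists_extremal hk wq b3.
  have tot1 : total_weight l1 = m.
    rewrite (total_two_valued wq lv1) -hm_tot (total_two_valued wq lv).
    by case: hD => _ _ _ ->; case: hD1 => _ _ _ ->.
  have [_ /(proj2) eq1] := bound D1 l1 hD1 lv1 tot1.
  have [lE1 _] := lv1.
  have in1 : in_BDk m k (weak_subdivision l1).
    exists D1; split=> //; exists l1; split=> //; last exact: mgraph_iso_refl.
      move=> C /and3P [/set0Pn [e eC] _ _]; rewrite (bigD1 e) //= addn_gt0.
      by case: (lE1 e) => ->; apply/orP; left.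
    by move=> e f; case: (lE1 e) => ->; case: (lE1 f) => ->; lia.
  have := minG _ in1; rewrite (ndisc_iso 3 hG) => le1.
  have [|trivD balD] := proj1 eqG; first by have := eq1 (conj triv1 bal1); lia.
  by split=> //; apply/pivP.
- split=> // G' [D' [hD' [l' [_ bal' tot' iso']]]].
  have [le' _] := bound D' l' hD' (values D' l' hD' bal' tot') tot'.
  rewrite (ndisc_iso 3 hG) (ndisc_iso 3 iso').
  by have := proj2 eqG (conj triv bal); lia.
Qed.
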